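(* Let $M$ and $M'$ be matroids where $M'$ is obtained from $M$ by either (a) a coloop contraction, or (b) a series contraction. Then $\mu(M)=\mu(M')$.
   Context: Throughout, matroids are finite and non-free (they have at least one circuit). $\mathbb{K}$ is a field. A coloop contraction is $M/e$ with $e$ a coloop of $M$; a series contraction is $M/e$ where $\{e,f\}$ is a cocircuit of $M$ for some $f$. A cycle of $M$ is a disjoint union of (possibly zero) circuits; $\mathrm{Cyc}(M)$ is the set of cycles. The cycle ideal $I_{\mathrm{Cyc}(M)}$ is the kernel of $\mathbb{K}[x_C:C\in\mathrm{Cyc}(M)]\to\mathbb{K}[y_e,z:e\in E(M)]$, $x_C\mapsto\prod_{e\in C}y_e\cdot z$; $\mu(M)$ is the highest degree of an element of a minimal homogeneous generating set of $I_{\mathrm{Cyc}(M)}$ (with $\deg 0=-\infty$). *)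

(* Defs.v *)
From mathcomp Require Import all_boot all_order all_algebra.
From mathcomp Require Import mpoly.
From mathcomp Require Import constructive_ereal.
From mathcomp Require classical_sets.

Set Implicit Arguments.
Unset Strict Implicit.
Unset Printing Implicit Defensive.

Import GRing.Theory.

Local Open Scope ring_scope.

(* The ground set is a subset of an ambient finite type, so that a matroid and
   its minors, whose ground sets differ, have the same type. *)
Record matroid (T : finType) := Matroid {
  ground : {set T};
  indep : {set {set T}};
  indep_ground : forall A : {set T}, A \in indep -> A \subset ground;
  indep0 : set0 \in indep;
  indep_sub : forall A B : {set T}, A \subset B -> B \in indep -> A \in indep;
  indep_aug : forall A B : {set T}, A \in indep -> B \in indep -> (#|A| < #|B|)%N ->
    exists2 x, x \in B :\: A & x |: A \in indep
}.

Section Matroids.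
Variable T : finType.
Implicit Types (M : matroid T) (e f : T) (A B C : {set T}).

Definition circuits M : {set {set T}} :=
  [set C | minset (fun A => (A \subset ground M) && (A \notin indep M)) C].

Definition non_free M : Prop := circuits M != set0.

Definition bases M : {set {set T}} :=
  [set B | maxset (fun A => A \in indep M) B].

Definition dual_indep M : {set {set T}} :=
  [set A : {set T} | (A \subset ground M) &&
     [exists B : {set T}, (B \in bases M) && [disjoint A & B]]].

Lemma bases_indep M B : B \in bases M -> B \in indep M.
Proof. by rewrite inE => /maxsetP []. Qed.

Lemma bases_card M A B : A \in indep M -> B \in bases M -> (#|A| <= #|B|)%N.
Proof.
move=> iA; rewrite inE => /maxsetP [iB maxB]; rewrite leqNgt; apply/negP => ltBA.
have [x /setDP [_ xB] ixB] := indep_aug iB iA ltBA.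
by case/negP: xB; rewrite -(maxB _ ixB (subsetUr _ _)) setU11.
Qed.

Lemma bases_extend M A B : A \in indep M -> B \in bases M ->
  exists2 B', B' \in bases M & A \subset B' /\ B' \subset A :|: B.
Proof.
move=> iA bB.
pose P := [pred X | [&& X \in indep M, A \subset X & X \subset A :|: B]].
have PA : P A by rewrite /= iA subxx subsetUl.
have [X /maxsetP [/and3P [iX sAX sXU] maxX] _] := maxset_exists PA.
exists X => //.
have leBX : (#|B| <= #|X|)%N.
  rewrite leqNgt; apply/negP => ltXB.
  have [x /setDP [xB xX] ixX] := indep_aug iX (bases_indep bB) ltXB.
  case/negP: xX; rewrite -(maxX (x |: X)) ?subsetUr ?setU11 //=.
  rewrite ixX (subset_trans sAX) ?subsetUr //= subUset sXU andbT.
  by rewrite sub1set inE xB orbT.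
rewrite inE; apply/maxsetP; split=> // Y iY sXY; apply/esym/eqP.
by rewrite eqEcard sXY (leq_trans (bases_card iY bB)).
Qed.

Lemma dual_indep_ground M A : A \in dual_indep M -> A \subset ground M.
Proof. by rewrite inE => /andP []. Qed.

Lemma dual_indep0 M : set0 \in dual_indep M.
Proof.
have [B maxB _] := maxset_exists (indep0 M : (fun A => A \in indep M) set0).
rewrite inE sub0set; apply/existsP; exists B.
by rewrite inE maxB -setI_eq0 set0I eqxx.
Qed.

Lemma dual_indep_sub M A B :
  A \subset B -> B \in dual_indep M -> A \in dual_indep M.
Proof.
move=> sAB; rewrite !inE => /andP [sB /existsP [X /andP [bX dBX]]].
rewrite (subset_trans sAB sB); apply/existsP; exists X.
by rewrite bX (disjointWl sAB dBX).
Qed.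

Lemma dual_indep_aug M I J :
  I \in dual_indep M -> J \in dual_indep M -> (#|I| < #|J|)%N ->
  exists2 x, x \in J :\: I & x |: I \in dual_indep M.
Proof.
rewrite !inE => /andP [sI /existsP [B /andP [bB dIB]]].
move=> /andP [sJ /existsP [B' /andP [bB' dJB']]] ltIJ.
have iBI : B' :\: I \in indep M.
  by apply: indep_sub (bases_indep bB'); apply: subsetDl.
have [X bX [sX1 sX2]] := bases_extend iBI bB.
have dIX : [disjoint I & X].
  rewrite -setI_eq0; apply/eqP/setP => x; rewrite in_setI in_set0.
  apply/negP => /andP [xI /(subsetP sX2)].
  by rewrite !inE xI (disjointFr dIB xI).
have [sJIX|] := boolP (J :\: I \subset X); last first.
  case/subsetPn => x xJI xX; exists x => //; rewrite inE.
  have /setDP [xJ _] := xJI.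
  rewrite subUset sub1set (subsetP sJ) //= sI; apply/existsP; exists X.
  by rewrite bX -setI_eq0 setIUl setU_eq0 !setI_eq0 dIX disjoints1 xX.
have dD : [disjoint B' :\: I & J :\: I].
  apply: disjointWl (subsetDl _ _) _; rewrite disjoint_sym.
  exact: disjointWl (subsetDl _ _) dJB'.
have leX : (#|B' :\: I| + #|J :\: I| <= #|X|)%N.
  have := (leq_card_setU (B' :\: I) (J :\: I)).2; rewrite dD => /eqP <-.
  by apply: subset_leq_card; rewrite subUset sX1.
have leXB : (#|X| <= #|B'|)%N := bases_card (bases_indep bX) bB'.
have leBI : (#|B' :&: I| <= #|I :\: J|)%N.
  apply: subset_leq_card; apply/subsetP => x /setIP [xB xI]; rewrite !inE xI andbT.
  by apply/negP => xJ; rewrite (disjointFr dJB' xJ) in xB.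
have := cardsID I B'; have := cardsID J I; have := cardsID I J.
rewrite (setIC J I) => e1 e2 e3.
move: ltIJ; rewrite ltnNge -e1 -e2 leq_add2l => /negP; case.
apply: leq_trans leBI; move: (leq_trans leX leXB).
by rewrite -e3 addnC leq_add2r.
Qed.

Definition dual M : matroid T :=
  Matroid (@dual_indep_ground M) (dual_indep0 M) (@dual_indep_sub M)
          (@dual_indep_aug M).

Definition cocircuits M : {set {set T}} := circuits (dual M).

Definition loop M e : Prop := [set e] \in circuits M.

Definition coloop M e : Prop := loop (dual M) e.

(* If e is a loop (or lies outside the ground set) then M / e = M \ e. *)
Definition contract_indep M e : {set {set T}} :=
  [set A : {set T} | (A \subset ground M :\ e) &&
     (if [set e] \in indep M then e |: A \in indep M else A \in indep M)].

Lemma contract_indep_ground M e A :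
  A \in contract_indep M e -> A \subset ground M :\ e.
Proof. by rewrite inE => /andP []. Qed.

Lemma contract_indep0 M e : set0 \in contract_indep M e.
Proof. by rewrite inE sub0set setU0 indep0; case: ifP. Qed.

Lemma contract_indep_sub M e A B :
  A \subset B -> B \in contract_indep M e -> A \in contract_indep M e.
Proof.
move=> sAB; rewrite !inE => /andP [sB]; rewrite (subset_trans sAB sB) /=.
by case: ifP => _; apply: indep_sub; rewrite ?setUS.
Qed.

Lemma contract_indep_aug M e A B :
  A \in contract_indep M e -> B \in contract_indep M e -> (#|A| < #|B|)%N ->
  exists2 x, x \in B :\: A & x |: A \in contract_indep M e.
Proof.
rewrite !inE => /andP [sA iA] /andP [sB iB] ltAB.
have sxA x : x \in B -> x |: A \subset ground M :\ e.
  by move=> xB; rewrite subUset sA andbT sub1set (subsetP sB).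
case: ifP iA iB => [ie|ie] iA iB; last first.
  have [x xBA ixA] := indep_aug iA iB ltAB.
  by exists x => //; rewrite inE ie ixA sxA //; case/setDP: xBA.
have eA : e \notin A by apply/negP => /(subsetP sA); rewrite !inE eqxx.
have eB : e \notin B by apply/negP => /(subsetP sB); rewrite !inE eqxx.
have ltAB' : (#|e |: A| < #|e |: B|)%N by rewrite !cardsU1 eA eB ltn_add2l.
have [x /setDP [xB xA] ixA] := indep_aug iA iB ltAB'.
move: xA xB; rewrite !inE => /norP [/negbTE -> xA] /= xB; exists x.
  by rewrite !inE xA.
by rewrite inE ie sxA //= setUCA.
Qed.

Definition contract M e : matroid T :=
  Matroid (@contract_indep_ground M e) (contract_indep0 M e)
          (@contract_indep_sub M e) (@contract_indep_aug M e).

Definition coloop_contraction M M' : Prop :=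
  exists2 e, coloop M e & M' = contract M e.

Definition series_contraction M M' : Prop :=
  exists e f, [/\ e != f, [set e; f] \in cocircuits M & M' = contract M e].

Definition cycles M : {set {set T}} :=
  [set cover P | P : {set {set T}} & (P \subset circuits M) && trivIset P].

End Matroids.

Section Ideals.
Variables (K : fieldType) (n : nat).
Implicit Types (I : {mpoly K[n]} -> Prop) (G : seq {mpoly K[n]}).

Definition in_ideal G (p : {mpoly K[n]}) : Prop :=
  exists c : 'I_(size G) -> {mpoly K[n]}, p = \sum_(i < size G) c i * G`_i.

Definition generates I G : Prop := forall p, I p <-> in_ideal G p.

Definition homogeneous (p : {mpoly K[n]}) : Prop := exists d, p \is d.-homog.

(* Minimality is with respect to inclusion. Lists suffice: the polynomial ring
   is noetherian, so an inclusion-minimal generating set is finite. *)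
Definition min_homog_gens I G : Prop :=
  [/\ forall g, g \in G -> homogeneous g,
      generates I G
    & forall G' : seq {mpoly K[n]},
        {subset G' <= G} -> generates I G' -> {subset G <= G'}].

(* msize is one more than the total degree *)
Definition degree (p : {mpoly K[n]}) : \bar int :=
  if p == 0 then -oo%E else ((msize p).-1%:Z)%:E.

(* The zero ideal has the empty minimal generating set, of highest degree -oo. *)
Definition max_degree G : \bar int := \big[Order.max/-oo%E]_(g <- G) degree g.

(* xget picks a value satisfying the predicate. For a homogeneous ideal there is
   exactly one: finite minimal homogeneous generating sets exist by Hilbert's
   basis theorem, and they all have the same degrees by the graded Nakayama
   lemma; so the default -oo plays no role. *)
Definition highest_gen_degree I : \bar int :=
  classical_sets.xget -oo%E (fun d => exists2 G, min_homog_gens I G & d = max_degree G).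

End Ideals.

Section CycleIdeal.
Variables (K : fieldType) (T : finType) (M : matroid T).

(* The variable x_C is 'X_i for i the index of C in the enumeration of the
   cycles; in the target ring z is 'X_0, and y_e is 'X_(j+1) for j the index
   of e in the enumeration of the ground set. *)
Definition cycle_monomials :
    #|cycles M|.-tuple {mpoly K[#|ground M|.+1]} :=
  [tuple (\prod_(j < #|ground M| | enum_val j \in (enum_val i : {set T}))
            'X_(lift ord0 j)) * 'X_ord0 | i < #|cycles M|].

Definition cycle_ideal (p : {mpoly K[#|cycles M|]}) : Prop :=
  p \mPo cycle_monomials = 0.

Definition mu : \bar int := highest_gen_degree cycle_ideal.

End CycleIdeal.

(* Main.v *)
Require Import Defs.
From mathcomp Require Import all_boot all_order all_algebra.
From mathcomp Require Import mpoly.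
From mathcomp Require boolp.

Set Implicit Arguments.
Unset Strict Implicit.
Unset Printing Implicit Defensive.

(* A circuit never meets a cocircuit in exactly one element. Hence no circuit
   contains a coloop e, and if {e, f} is a cocircuit, then a circuit contains e
   iff it contains f. In both cases the circuits of M / e are the sets C \ e for
   C a circuit of M, and C -> C \ e is a bijection between the cycles of M and
   those of M / e. The induced bijection of the variables x_C carries one cycle
   ideal onto the other: setting y_e = 1 maps the monomials of M to those of
   M / e, and replacing y_f by y_e y_f (or nothing, for a coloop) maps them back.
   Such a renaming of variables preserves minimal homogeneous generating sets
   and their degrees. *)

(** * Circuits, cocircuits and bases *)

Section Circuits.
Variables (T : finType) (M : matroid T).
Implicit Types (e x : T) (A B C D F : {set T}).

Lemma circuit_ground C : C \in circuits M -> C \subset ground M.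
Proof. by rewrite inE => /minsetP [/andP []]. Qed.

Lemma circuit_dep C : C \in circuits M -> C \notin indep M.
Proof. by rewrite inE => /minsetP [/andP []]. Qed.

Lemma circuit_min C D : C \in circuits M ->
  D \subset C -> D \notin indep M -> D = C.
Proof.
move=> cC sDC dD; move: (cC); rewrite inE => /minsetP [_]; apply=> //.
by rewrite (subset_trans sDC (circuit_ground cC)).
Qed.

Lemma circuit_antichain C D :
  C \in circuits M -> D \in circuits M -> D \subset C -> D = C.
Proof. by move=> cC /circuit_dep dD /(circuit_min cC); apply. Qed.

Lemma circuit_del_indep C x : C \in circuits M -> x \in C -> C :\ x \in indep M.
Proof.
move=> cC xC; apply/negPn/negP => /(circuit_min cC (subsetDl _ _)) /setP /(_ x).
by rewrite !inE eqxx xC.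
Qed.

Lemma dep_circuit A : A \subset ground M -> A \notin indep M ->
  exists2 C, C \in circuits M & C \subset A.
Proof.
move=> sA dA; have PA : (A \subset ground M) && (A \notin indep M) by rewrite sA.
have [C minC sCA] := minset_exists (P := fun A => _ && (A \notin indep M)) PA.
by exists C; rewrite // inE.
Qed.

Lemma cocircuit_meets_basis A B :
  A \in cocircuits M -> B \in bases M -> ~~ [disjoint A & B].
Proof.
rewrite inE => /minsetP [/andP [sA dA] _] bB; apply: contra dA => dAB.
by rewrite inE; apply/andP; split=> //; apply/existsP; exists B; rewrite bB.
Qed.

(** By minimality of the cocircuit, [A :\ x] is independent in the dual, that is, it misses some
    basis. *)
Lemma cocircuit_del_basis A x : A \in cocircuits M -> x \in A ->
  exists2 B, B \in bases M & [disjoint A :\ x & B].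
Proof.
rewrite inE => /minsetP [/andP [sA dA] minA] xA.
have : A :\ x \in dual_indep M.
  apply/negPn/negP => dAx; have /setP /(_ x) : A :\ x = A.
    by apply: minA (subsetDl _ _); rewrite dAx (subset_trans (subsetDl _ _) sA).
  by rewrite !inE eqxx xA.
by rewrite inE => /andP [_ /existsP [B /andP [bB dB]]]; exists B.
Qed.

(** A basis missing [A :\ x] still meets [A], so it contains [x]. This makes the contracted element
    a non-loop, so that [contract] takes its first branch. *)
Lemma cocircuit_elt_indep A x :
  A \in cocircuits M -> x \in A -> [set x] \in indep M.
Proof.
move=> cA xA; have [B bB dB] := cocircuit_del_basis cA xA.
apply: indep_sub (bases_indep bB); rewrite sub1set.
have /pred0Pn [y /= /andP [yA yB]] := cocircuit_meets_basis cA bB.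
case: (eqVneq y x) => [<- //|nyx].
by rewrite (disjointFr dB) // !inE nyx in yB.
Qed.

(* If a circuit C meets a cocircuit A in {e} only, then C \ e extends, by
   elements of a basis missing A \ e, to a basis B with A \cap B \subset {e};
   B meets A, so it contains e, hence all of C. *)
Lemma circuit_cocircuit A C e : A \in cocircuits M -> C \in circuits M ->
  e \in A -> e \in C -> exists2 f, f != e & (f \in A) && (f \in C).
Proof.
move=> cA cC eA eC; case: (pickP [pred f | [&& f != e, f \in A & f \in C]]).
  by move=> f /andP [nfe fAC]; exists f.
move=> noF; have [B1 bB1 dB1] := cocircuit_del_basis cA eA.
have [B bB [sCB sB]] := bases_extend (circuit_del_indep cC eC) bB1.
have /pred0Pn [y /= /andP [yA yB]] := cocircuit_meets_basis cA bB.
case/negP: (circuit_dep cC); apply: indep_sub (bases_indep bB).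
suff eB : e \in B by rewrite -(setD1K eC) subUset sub1set eB.
case: (eqVneq y e) => [<- //|nye].
have := subsetP sB _ yB; rewrite !inE nye /=.
have := noF y; rewrite /= nye yA /= => -> /=.
by rewrite (disjointFr dB1) // !inE nye.
Qed.

End Circuits.

(** * Circuits and cycles of the contraction *)

Section Contraction.
Variables (T : finType) (M : matroid T) (e : T) (F : {set T}).
Implicit Types (C D Z : {set T}).

(* Common to coloop contractions, with F empty, and to series contractions,
   with F = {f}. *)
Hypotheses (eF : e \notin F) (F1 : (#|F| <= 1)%N) (e_indep : [set e] \in indep M).
Hypothesis mem_circuit :
  forall C, C \in circuits M -> (e \in C) = ~~ [disjoint C & F].

Lemma meets_singleton C x : ~~ [disjoint C & F] -> x \in F -> x \in C.
Proof.
case/pred0Pn=> y /= /andP [yC yF] xF.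
by rewrite (card_le1_eqP F1 _ _ yF xF : x = y).
Qed.

Lemma disjoint_del C : [disjoint C :\ e & F] = [disjoint C & F].
Proof.
apply/pred0P/pred0P => /= h x; have /= := h x; rewrite !inE.
  by case: eqVneq => //= ->; rewrite (negbTE eF) andbF.
by case: eqVneq => //= _ ->.
Qed.

Lemma indep_contract C :
  (C \in indep (contract M e)) = (C \subset ground M :\ e) && (e |: C \in indep M).
Proof. by rewrite inE e_indep. Qed.

(** Deleting [e] loses no information: since [e] is outside [F], whether a circuit contains [e] can
    be read off from the trace on [F] of what remains. *)
Lemma circuit_del_sub C D : C \in circuits M -> D \in circuits M ->
  C :\ e \subset D :\ e -> C \subset D.
Proof.
move=> cC cD sCD; apply/subsetP => x xC; case: (eqVneq x e) => [xe|nxe].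
  rewrite xe in xC *; rewrite (mem_circuit cD) -disjoint_del.
  move: xC; rewrite (mem_circuit cC) -disjoint_del; apply: contra.
  exact: disjointWl.
by move/subsetP: sCD => /(_ x); rewrite !inE nxe => /(_ xC).
Qed.

(** A set is dependent in M / e iff it contains some [C :\ e] with C a circuit of M. By
    [circuit_del_sub] these sets form an antichain, so they are the minimal ones. *)
Lemma circuits_contract :
  circuits (contract M e) = [set C :\ e | C in circuits M].
Proof.
have dep C D : C \in circuits M -> C :\ e \subset D -> e |: D \notin indep M.
  move=> cC sCD; apply: contra (circuit_dep cC); apply: indep_sub.
  apply: subset_trans (setUS _ sCD); apply/subsetP => x; rewrite !inE.
  by case: eqP.
have gr D : D \subset ground M :\ e -> e |: D \subset ground M.
  move=> sD; rewrite subUset -(setD1K (_ : e \in ground M)).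
    by rewrite subsetUl (subset_trans sD) ?subsetUr.
  by rewrite -sub1set indep_ground.
have dep_ex D : D \subset ground M :\ e -> D \notin indep (contract M e) ->
    exists2 C, C \in circuits M & C :\ e \subset D.
  move=> sD; rewrite indep_contract sD /= => /(dep_circuit (gr _ sD)).
  by case=> C cC sCD; exists C; rewrite // subDset.
apply/setP=> D; apply/idP/imsetP => [cD|[C cC ->{D}]].
  have [C cC sCD] := dep_ex _ (circuit_ground cD) (circuit_dep cD).
  exists C => //; apply/esym/(circuit_min cD) => //.
  by rewrite indep_contract negb_and (dep _ _ cC) ?orbT.
rewrite inE; apply/minsetP; split.
  rewrite setSD ?circuit_ground //= indep_contract negb_and.
  by rewrite (dep _ _ cC) ?orbT.
move=> D /andP [sDg dD] sDC; have [C' cC' sC'D] := dep_ex _ sDg dD.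
apply/eqP; rewrite eqEsubset sDC /=.
by rewrite -(circuit_antichain cC cC') // circuit_del_sub ?(subset_trans sC'D).
Qed.

(** Two circuits through [e] both meet [F]; as [F] has at most one element, they also share that
    element, which differs from [e]. *)
Lemma circuit_del_disjoint C D : C \in circuits M -> D \in circuits M ->
  [disjoint C :\ e & D :\ e] = [disjoint C & D].
Proof.
move=> cC cD; apply/idP/idP => [dCD|]; last first.
  by move/(disjointWl (subsetDl C [set e]))/(disjointWr (subsetDl D [set e])).
apply/pred0P => x /=; apply/negP => /andP [xC xD].
case: (eqVneq x e) => [xe|nxe]; last first.
  have := disjointFr dCD (x := x); rewrite !inE nxe xC xD => H.
  by have := H isT.
rewrite xe (mem_circuit cC) in xC; rewrite xe (mem_circuit cD) in xD.
have /pred0Pn [y /= /andP [yC yF]] := xC.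
have nye : y != e by apply: contraNneq eF => <-.
have := disjointFr dCD (x := y); rewrite !inE nye yC (meets_singleton xD yF) => H.
by have := H isT.
Qed.

(** Both sides hold for a union iff they hold for one of its circuits. *)
Lemma mem_cycle Z : Z \in cycles M -> (e \in Z) = ~~ [disjoint Z & F].
Proof.
case/imsetP=> P; rewrite inE => /andP [sP _] ->.
apply/bigcupP/pred0Pn => [[C CP]|[x /andP [/bigcupP [C CP xC] xF]]].
  rewrite (mem_circuit (subsetP sP _ CP)) => /pred0Pn [x /= /andP [xC xF]].
  by exists x; rewrite /= xF andbT; apply/bigcupP; exists C.
exists C => //; rewrite (mem_circuit (subsetP sP _ CP)).
by apply/pred0Pn; exists x; rewrite /= xC.
Qed.

Lemma cycle_del_inj : {in cycles M &, injective (fun Z => Z :\ e)}.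
Proof.
move=> Z1 Z2 cZ1 cZ2 eqZ; apply/setP => x; case: (eqVneq x e) => [->|nxe].
  by rewrite !mem_cycle // -(disjoint_del Z1) eqZ disjoint_del.
by have /setP /(_ x) := eqZ; rewrite !inE nxe.
Qed.

Lemma cover_del (P : {set {set T}}) :
  cover [set C :\ e | C in P] = cover P :\ e.
Proof.
apply/setP => x; rewrite cover_imset !inE; apply/bigcupP/andP.
  by case=> C CP; rewrite !inE => /andP [-> xC]; split=> //; apply/bigcupP; exists C.
by case=> nxe /bigcupP [C CP xC]; exists C; rewrite // !inE nxe.
Qed.

Lemma cycles_contract : cycles (contract M e) = [set Z :\ e | Z in cycles M].
Proof.
have triv (P : {set {set T}}) : P \subset circuits M ->
    trivIset [set C :\ e | C in P] = trivIset P.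
  move=> sP; apply/trivIsetP/trivIsetP => tP.
    move=> C D CP DP nCD; rewrite -circuit_del_disjoint ?(subsetP sP) //.
    (* Distinct circuits have distinct images, by [circuit_del_sub] and the antichain property. *)
    apply: tP; rewrite ?(imset_f (fun C => C :\ e)) //; apply: contraNneq nCD => eqCD.
    have cC : C \in circuits M := subsetP sP _ CP.
    have cD : D \in circuits M := subsetP sP _ DP.
    have sCD : C \subset D by apply: circuit_del_sub => //; rewrite eqCD.
    by rewrite (circuit_antichain cD cC sCD).
  move=> _ _ /imsetP [C CP ->] /imsetP [D DP ->] nCD.
  rewrite circuit_del_disjoint ?(subsetP sP) //; apply: tP => //.
  by apply: contraNneq nCD => ->.
apply/setP=> Z; apply/imsetP/imsetP => [[P' + ->]|[_ /imsetP [P + ->] ->]].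
  rewrite inE circuits_contract => /andP [sP' tP'].
  have [P sP eqP'] : exists2 P : {set {set T}}, P \subset circuits M &
      P' = [set C :\ e | C in P].
    exists [set C in circuits M | C :\ e \in P'].
      by apply/subsetP => C; rewrite inE => /andP [].
    apply/setP => D; apply/idP/imsetP => [DP|[C + ->]]; last by rewrite inE => /andP [].
    have /imsetP [C cC eqD] := subsetP sP' _ DP.
    by exists C; rewrite // inE cC -eqD.
  exists (cover P); last by rewrite eqP' cover_del.
  by apply/imsetP; exists P; rewrite // inE sP -triv // -eqP' tP'.
rewrite inE => /andP [sP tP]; exists [set C :\ e | C in P].
  by rewrite inE circuits_contract imsetS //= triv.
by rewrite cover_del.
Qed.

End Contraction.

Import GRing.Theory.
Local Open Scope ring_scope.

(** * Substitution and renaming of variables *)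

Section CompMpoly.
Variables (R : comNzRingType) (n k : nat).

Lemma comp_mpolyA l (p : {mpoly R[n]}) (s : n.-tuple {mpoly R[k]})
    (t : k.-tuple {mpoly R[l]}) :
  (p \mPo s) \mPo t = p \mPo [tuple tnth s i \mPo t | i < n].
Proof.
rewrite (comp_mpolyE p s) (comp_mpolyE p) raddf_sum; apply: eq_bigr => m _ /=.
rewrite comp_mpolyZ rmorph_prod; congr (_ *: _); apply: eq_bigr => i _.
by rewrite rmorphXn tnth_mktuple.
Qed.

Lemma dhomog_rename (s : 'I_n -> 'I_k) (p : {mpoly R[n]}) d :
  p \is d.-homog -> p \mPo [tuple 'X_(s i) | i < n] \is d.-homog.
Proof.
move=> /dhomogP hp; rewrite comp_mpolyE big_seq; apply: rpred_sum => m /hp /= <-.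
apply: rpredZ; rewrite mdegE; elim/big_rec2: _ => [|i q e _ hq].
  exact: dhomog1.
apply: dhomogM hq; rewrite tnth_mktuple -[X in X.-homog]mul1n.
by apply: dhomogMn; rewrite dhomogX /= mdeg1.
Qed.

End CompMpoly.

Lemma comp_mpoly_renameK (R : comNzRingType) n k (s : 'I_n -> 'I_k)
    (s' : 'I_k -> 'I_n) : cancel s s' ->
  cancel (comp_mpoly [tuple ('X_(s i) : {mpoly R[k]}) | i < n])
         (comp_mpoly [tuple 'X_(s' i) | i < k]).
Proof.
move=> sK p; rewrite comp_mpolyA -[RHS]comp_mpoly_id; congr (_ \mPo _).
apply: eq_mktuple => i.
by rewrite tnth_mktuple comp_mpolyXU -tnth_nth tnth_mktuple sK.
Qed.

(** * Invariance of generator degrees under graded isomorphisms *)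

Section IdealIso.
Variable K : fieldType.

Lemma in_ideal_map n k (phi : {rmorphism {mpoly K[n]} -> {mpoly K[k]}}) G p :
  in_ideal G p -> in_ideal (map phi G) (phi p).
Proof.
case=> c ->; exists (fun i => phi (c (cast_ord (size_map phi G) i))).
rewrite rmorph_sum (reindex (cast_ord (size_map phi G))) /=; last first.
  by apply: onW_bij; exists (cast_ord (esym (size_map phi G))) => i; apply: val_inj.
by apply: eq_bigr => i _; rewrite rmorphM (nth_map 0) // -(size_map phi).
Qed.

Lemma degree_homog n k (p : {mpoly K[n]}) (q : {mpoly K[k]}) d :
  (p == 0) = (q == 0) -> p \is d.-homog -> q \is d.-homog -> degree p = degree q.
Proof.
rewrite /degree => pq hp hq; rewrite pq; case: ifPn => // q0.
have p0 : p != 0 by rewrite pq.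
suff -> : (msize p).-1 = (msize q).-1 by [].
rewrite (dhomog_uniq p0 (dhomog_msize hp) hp).
by rewrite (dhomog_uniq q0 (dhomog_msize hq) hq).
Qed.

Section Transfer.
Variables (n k : nat) (phi : {rmorphism {mpoly K[n]} -> {mpoly K[k]}})
  (psi : {rmorphism {mpoly K[k]} -> {mpoly K[n]}}).
Variables (I : {mpoly K[n]} -> Prop) (J : {mpoly K[k]} -> Prop).
Hypotheses (phiK : cancel phi psi) (psiK : cancel psi phi).
Hypothesis phi_homog : forall d p, p \is d.-homog -> phi p \is d.-homog.
Hypothesis IJ : forall p, I p <-> J (phi p).

(** A generating sublist of the image pulls back along [psi] to one of [G], which has all elements
    of [G] by minimality; applying [phi] again gives the claim. *)
Lemma min_homog_gens_map G : min_homog_gens I G -> min_homog_gens J (map phi G).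
Proof.
case=> homG genG minG; split=> [_ /mapP [g gG ->]|q|G' sG' genG'].
- by have [d hd] := homG g gG; exists d; apply: phi_homog.
- rewrite -(psiK q) -IJ (genG (psi q)); split; first exact: in_ideal_map.
  by move/(in_ideal_map psi); rewrite mapK // psiK.
have sG : {subset map psi G' <= G}.
  by move=> _ /mapP [q /sG' /mapP [g gG ->] ->]; rewrite phiK.
have {}genG' : generates I (map psi G').
  move=> p; rewrite IJ (genG' (phi p)); split=> [/(in_ideal_map psi)|].
    by rewrite phiK.
  by move/(in_ideal_map phi); rewrite mapK.
move=> _ /mapP [g /(minG _ sG genG') gG' ->].
by have /mapP [q qG' ->] := gG'; rewrite psiK.
Qed.

Lemma max_degree_map G :
  min_homog_gens I G -> max_degree (map phi G) = max_degree G.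
Proof.
case=> homG _ _; rewrite /max_degree big_map; apply: eq_big_seq => g gG.
have [d hd] := homG g gG; apply: degree_homog (phi_homog hd) hd.
by rewrite -(can_eq phiK g) rmorph0.
Qed.

End Transfer.

Lemma highest_gen_degree_iso n k
    (phi : {rmorphism {mpoly K[n]} -> {mpoly K[k]}})
    (psi : {rmorphism {mpoly K[k]} -> {mpoly K[n]}}) I J :
  cancel phi psi -> cancel psi phi ->
  (forall d p, p \is d.-homog -> phi p \is d.-homog) ->
  (forall d p, p \is d.-homog -> psi p \is d.-homog) ->
  (forall p, I p <-> J (phi p)) ->
  highest_gen_degree I = highest_gen_degree J.
Proof.
move=> phiK psiK phiH psiH IJ; pose max_degrees m (L : {mpoly K[m]} -> Prop) :=
  fun d => exists2 G, min_homog_gens L G & d = max_degree G.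
(* The value chosen by [xget] depends only on the predicate, so it suffices that both ideals admit
   the same maximal degrees. *)
suff eqIJ : max_degrees n I = max_degrees k J.
  by rewrite /highest_gen_degree -/(max_degrees n I) eqIJ.
apply: boolp.funext => d; apply: boolp.propext.
split=> [[G minG ->]|[G minG ->]].
  exists (map phi G); first exact: min_homog_gens_map minG.
  by rewrite (max_degree_map phiK phiH minG).
have JI q : J q <-> I (psi q) by rewrite IJ psiK.
exists (map psi G); first exact: min_homog_gens_map minG.
by rewrite (max_degree_map psiK psiH minG).
Qed.

End IdealIso.

(** * Cycle monomials and comparison of cycle ideals *)

Section CycleMonomials.
Variables (K : fieldType) (T : finType).
Implicit Types (M : matroid T) (C : {set T}).

(* The variable y_x, with y_x = 1 if x is outside the ground set. *)
Definition yvar M (x : T) : {mpoly K[#|ground M|.+1]} :=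
  \prod_(j < #|ground M| | enum_val j == x) 'X_(lift ord0 j).

Definition cycle_monomial M C := (\prod_(x in C) yvar M x) * 'X_ord0.

(** Encodes the ring map that fixes z, which has index 0, and sends each y_x to [w x]. *)
Definition subst M k (w : T -> {mpoly K[k.+1]}) : #|ground M|.+1.-tuple {mpoly K[k.+1]} :=
  [tuple oapp (fun j => w (enum_val j)) 'X_ord0 (unlift ord0 i) | i < #|ground M|.+1].

Lemma cycle_monomialE M C : cycle_monomial M C =
  (\prod_(j < #|ground M| | enum_val j \in C) 'X_(lift ord0 j)) * 'X_ord0.
Proof.
congr (_ * _); rewrite (partition_big (fun j => enum_val j) (mem C)) //=.
apply: eq_bigr => x xC; apply: eq_bigl => j.
by case: eqP => [->|]; rewrite ?xC ?andbF.
Qed.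

Lemma tnth_cycle_monomials M i :
  tnth (cycle_monomials K M) i = cycle_monomial M (enum_val i).
Proof. by rewrite tnth_mktuple cycle_monomialE. Qed.

Lemma yvar_out M x : x \notin ground M -> yvar M x = 1.
Proof.
move=> xM; apply: big1 => j /eqP jx.
by move: xM; rewrite -jx enum_valP.
Qed.

Lemma cycle_monomial_subst M C k (w : T -> {mpoly K[k.+1]}) : C \subset ground M ->
  cycle_monomial M C \mPo subst M w = (\prod_(x in C) w x) * 'X_ord0.
Proof.
move=> sC; rewrite cycle_monomialE rmorphM rmorph_prod /=.
rewrite comp_mpolyXU -tnth_nth tnth_mktuple unlift_none /=; congr (_ * _).
transitivity (\prod_(x in ground M | x \in C) w x).
  rewrite big_enum_val_cond /=; apply: eq_bigr => j _.
  by rewrite comp_mpolyXU -tnth_nth tnth_mktuple liftK.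
by apply: eq_bigl => x; rewrite andbC; case: (boolP (x \in C)) => // /(subsetP sC).
Qed.

Lemma cycle_ground M C : C \in cycles M -> C \subset ground M.
Proof.
case/imsetP=> P; rewrite inE => /andP [sP _] ->; apply/bigcupsP => D DP.
by apply: circuit_ground; apply: (subsetP sP).
Qed.

Lemma cycles0 M : set0 \in cycles M.
Proof.
apply/imsetP; exists set0; last by rewrite /cover big_set0.
by rewrite inE sub0set; apply/trivIsetP => A B; rewrite inE.
Qed.

(** The maps given by [w] and [w'] carry the monomial of C to that of [g C] and back. Hence a
    polynomial vanishes on one family of monomials iff its renaming vanishes on the other. *)
Lemma mu_eq M M' (g : {set T} -> {set T})
    (w : T -> {mpoly K[#|ground M'|.+1]}) (w' : T -> {mpoly K[#|ground M|.+1]}) :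
  {in cycles M &, injective g} -> cycles M' = g @: cycles M ->
  {in cycles M, forall C, \prod_(x in C) w x = \prod_(x in g C) yvar M' x} ->
  {in cycles M, forall C, \prod_(x in g C) w' x = \prod_(x in C) yvar M x} ->
  mu K M = mu K M'.
Proof.
move=> g_inj cM' wE w'E.
have gM' C : C \in cycles M -> g C \in cycles M' by move=> cC; rewrite cM' imset_f.
pose s (i : 'I_#|cycles M|) := enum_rank_in (cycles0 M') (g (enum_val i)).
have sE i : enum_val (s i) = g (enum_val i).
  by rewrite enum_rankK_in ?gM' ?enum_valP.
have s_inj : injective s.
  move=> i j /(congr1 enum_val); rewrite !sE => /g_inj eq_ij.
  by apply: enum_val_inj; apply: eq_ij; apply: enum_valP.
have [|s' sK s'K] := inj_card_bij s_inj.
  by rewrite !card_ord cM' card_in_imset.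
apply: (highest_gen_degree_iso (phi := comp_mpoly [tuple 'X_(s i) | i < _])
         (psi := comp_mpoly [tuple 'X_(s' i) | i < _])) => [||d p|d p|p].
- exact: comp_mpoly_renameK.
- exact: comp_mpoly_renameK.
- exact: dhomog_rename.
- exact: dhomog_rename.
(* The monomials of M', listed in the order of the cycles of M. *)
pose t := [tuple cycle_monomial M' (g (enum_val i)) | i < #|cycles M|].
rewrite /cycle_ideal comp_mpolyA.
have -> : [tuple tnth [tuple 'X_(s i0) | i0 < #|cycles M|] i \mPo cycle_monomials K M'
            | i < #|cycles M|] = t.
  apply: eq_mktuple => i.
  by rewrite tnth_mktuple comp_mpolyXU -tnth_nth tnth_cycle_monomials sE.
split=> p0.
  suff -> : t = [tuple tnth (cycle_monomials K M) i \mPo subst M w | i < #|cycles M|].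
    by rewrite -comp_mpolyA p0 comp_mpoly0.
  apply: eq_mktuple => i; rewrite tnth_cycle_monomials.
  by rewrite cycle_monomial_subst ?wE ?cycle_ground ?enum_valP.
suff -> : cycle_monomials K M = [tuple tnth t i \mPo subst M' w' | i < #|cycles M|].
  by rewrite -comp_mpolyA p0 comp_mpoly0.
apply: eq_from_tnth => i; rewrite tnth_cycle_monomials !tnth_mktuple.
by rewrite cycle_monomial_subst ?w'E ?cycle_ground ?gM' ?enum_valP.
Qed.

Lemma mu_contract M (e : T) (F : {set T}) :
  e \notin F -> (#|F| <= 1)%N -> [set e] \in indep M ->
  (forall C, C \in circuits M -> (e \in C) = ~~ [disjoint C & F]) ->
  mu K M = mu K (contract M e).
Proof.
move=> eF F1 ie FE.
have delK C : e \notin C -> C :\ e = C.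
  by move=> eC; apply/setDidPl; rewrite disjoint_sym disjoints1.
(* Since [e] is outside the ground set of M / e, the first substitution sets y_e to 1; the second
   restores y_e through the element of [F]. *)
apply: (@mu_eq _ _ (fun C => C :\ e) (yvar (contract M e))
  (fun x => if x \in F then yvar M e * yvar M x else yvar M x)).
- exact: cycle_del_inj FE.
- exact: cycles_contract FE.
- move=> C _; case: (boolP (e \in C)) => [eC|/delK -> //].
  by rewrite (big_setD1 e) //= yvar_out ?mul1r // !inE eqxx.
move=> C /(mem_cycle FE) eCF; rewrite -[in RHS](setIid C).
(* The factors y_e are split off: C meets [F] in exactly one element if it contains [e], and in none
   otherwise, so y_e appears once or not at all. *)
rewrite (eq_bigr (fun x => (if x \in F then yvar M e else 1) * yvar M x)); last first.
  by move=> x _; case: ifP; rewrite ?mul1r.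
rewrite big_split -big_mkcondr /= setIid.
case: (boolP (e \in C)) => eC; last first.
  rewrite delK // big_pred0 ?mul1r // => x.
  by move: eC; rewrite eCF negbK => /pred0P /(_ x).
rewrite [RHS](big_setD1 e) //=; congr (_ * _).
move: eC; rewrite eCF => CF; have /pred0Pn [f /= /andP [fC fF]] := CF.
rewrite (big_pred1 f) // => x; rewrite !inE; apply/andP/eqP => [[_ xF]|->].
  exact: (card_le1_eqP F1).
by rewrite fC fF andbT; split=> //; apply: contraNneq eF => <-.
Qed.

End CycleMonomials.

Theorem theorem6p7 (K : fieldType) (T : finType) (M M' : matroid T)
    (hM : non_free M) (hM' : non_free M')
    (hMM' : coloop_contraction M M' \/ series_contraction M M') :
  mu K M = mu K M'.
Proof.
case: hMM' => [[e le ->]|[e [f [nef cef ->]]]].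
  (* For a coloop, [[set e]] is a cocircuit, and a circuit through [e] would have to meet it in a
     second element. *)
  apply: (@mu_contract K T M e set0); rewrite ?inE ?cards0 //.
    exact: cocircuit_elt_indep le (set11 e).
  move=> C cC; rewrite -setI_eq0 setI0 eqxx; apply: negbTE; apply/negP => eC.
  have [x nxe] := circuit_cocircuit le cC (set11 e) eC.
  by rewrite inE (negbTE nxe).
(* A circuit containing one element of the cocircuit [[set e; f]] must contain the other. *)
apply: (@mu_contract K T M e [set f]); rewrite ?inE ?cards1 //.
  exact: cocircuit_elt_indep cef (set21 e f).
move=> C cC; rewrite disjoint_sym disjoints1 negbK; apply/idP/idP => [eC|fC].
  have [x nxe] := circuit_cocircuit cef cC (set21 e f) eC.
  by rewrite !inE (negbTE nxe) => /andP [/eqP ->].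
have [x nxf] := circuit_cocircuit cef cC (set22 e f) fC.
by rewrite !inE (negbTE nxf) orbF => /andP [/eqP ->].
Qed.
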